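(* The set $\mathscr{E}$ of all matrix sequences $\{A_n\}_n$ with $A_n\in\mathbb{C}^{n\times n}$ is complete with respect to the pseudometric $d_{acs}$; that is, every sequence of elements of $\mathscr{E}$ that is Cauchy for $d_{acs}$ converges, with respect to $d_{acs}$, to some element of $\mathscr{E}$.
   Context: $\mathscr{E}:=\{\{A_n\}_{n\ge 1} : A_n\in\mathbb{C}^{n\times n}\}$. For $A\in\mathbb{C}^{n\times n}$ let $\sigma_1(A)\ge\dots\ge\sigma_n(A)$ be its singular values, put $\sigma_{n+1}(A):=0$, and define $p(A):=\min_{i=1,\dots,n+1}\left\{\frac{i-1}{n}+\sigma_i(A)\right\}$. For $\{A_n\}_n\in\mathscr{E}$ set $\rho(\{A_n\}_n):=\limsup_{n\to\infty}p(A_n)$, and set $d_{acs}(\{A_n\}_n,\{B_n\}_n):=\rho(\{A_n-B_n\}_n)$, which is a pseudometric on $\mathscr{E}$. *)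

(* Defs.v *)
From HB Require Import structures.
From mathcomp Require Import all_boot all_order all_algebra.
From mathcomp Require Import complex.
From mathcomp Require Import all_classical all_reals all_analysis.

Set Implicit Arguments.
Unset Strict Implicit.
Unset Printing Implicit Defensive.

Import Order.TTheory GRing.Theory Num.Theory.
Import numFieldNormedType.Exports.

Local Open Scope ring_scope.
Local Open Scope sesquilinear_scope.

(* Since A^t* *m A is Hermitian, [spectral_diag] lists its n eigenvalues with
   multiplicity; they are nonnegative reals, so [complex.Re] is just the
   retraction R[i] -> R.  ([sort >=%R] sorts in nonincreasing order.) *)
Definition singular_values (R : realType) (n : nat) (A : 'M[R[i]]_n) : seq R :=
  sort >=%R
    [seq Num.sqrt (complex.Re (spectral_diag (A^t* *m A) 0 i)) | i <- enum 'I_n].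

(* [sigma A i] is the i-th largest singular value, with i counted from 1; the
   default value of [nth] provides the convention sigma_(n+1) = 0. *)
Definition sigma (R : realType) (n : nat) (A : 'M[R[i]]_n) (i : nat) : R :=
  nth 0 (singular_values A) i.-1.

Definition acs_term (R : realType) (n : nat) (A : 'M[R[i]]_n) (i : nat) : R :=
  (i.-1)%:R / n%:R + sigma A i.

(* The minimum over i = 1, ..., n + 1; the index k : 'I_n.+1 stands for
   i = k + 1, and the seed of the iterated minimum is the term i = 1. *)
Definition acs_p (R : realType) (n : nat) (A : 'M[R[i]]_n) : R :=
  \big[Num.min/acs_term A 1]_(k < n.+1) acs_term A k.+1.

(* A sequence {A_n} indexed by n >= 1: the matrix A_n is [A n.-1]. *)
Definition matseq (R : realType) : Type := forall n : nat, 'M[R[i]]_n.+1.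

(* The values of [acs_p] lie in [0, 1] for matrices of positive size (the term
   i = n + 1 is 1), so that the real-valued limit superior is the usual one. *)
Definition acs_rho (R : realType) (A : matseq R) : R :=
  limn_sup (fun n => acs_p (A n)).

Definition d_acs (R : realType) (A B : matseq R) : R :=
  acs_rho (fun n => A n - B n).

(* Main.v *)
Require Import Defs.
From HB Require Import structures.
From mathcomp Require Import all_boot all_order all_algebra.
From mathcomp Require Import complex.
From mathcomp Require Import all_classical all_reals all_analysis.

Import Order.TTheory GRing.Theory Num.Theory.
Import numFieldNormedType.Exports.

Local Open Scope classical_set_scope.
Local Open Scope ring_scope.

(* Diagonal argument: choose ranks m_j such that for n >= m_j and all i <= j,
   p(X_i,n - X_j,n) < d(X_i, X_j) + 1/(j+1), and let Y_n := X_{j(n),n}, where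
   j(n) <= n is the largest j with m_j <= n.  As j(n) tends to infinity, for
   each fixed i the number p(X_i,n - Y_n) is eventually bounded by
   d(X_i, X_j) + 1/(j+1) with j = j(n) arbitrarily large, which the Cauchy
   property makes small.  About p this only uses 0 <= p <= 1; in particular
   the triangle inequality for d_acs is not needed. *)

Section limn_sup_bounded.
Variables (R : realType) (u : R^nat).
Hypotheses (u_ub : has_ubound (range u)) (u_lb : has_lbound (range u)).

(** Boundedness makes the tail suprema [sups u] converge; they eventually drop below [c], and each
    [sups u n] dominates [u n]. *)
Lemma limn_sup_lt_near (c : R) :
  limn_sup u < c -> \forall n \near \oo, u n < c.
Proof.
have cu : cvgn (sups u) by apply/cvg_ex; eexists; exact: cvg_sups_inf.
move=> /(cvgr_lt _ cu); apply: filterS => n; apply: le_lt_trans.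
by apply: ub_le_sup; [exact: has_ubound_sdrop | exists n => /=].
Qed.

Lemma limn_sup_le_near (c : R) :
  (\forall n \near \oo, u n <= c) -> limn_sup u <= c.
Proof.
have cu : cvgn (sups u) by apply/cvg_ex; eexists; exact: cvg_sups_inf.
move=> [N _ uc]; apply: limr_le => //; exists N => // n /= Nn.
apply: ge_sup; first by exists (u n), n => /=.
by move=> _ [k /= nk <-]; apply: uc; exact: leq_trans Nn nk.
Qed.

Lemma limn_sup_ge (c : R) : (forall n, c <= u n) -> c <= limn_sup u.
Proof.
have cu : cvgn (sups u) by apply/cvg_ex; eexists; exact: cvg_sups_inf.
move=> cle; apply: limr_ge => //; apply: nearW => n; apply: le_trans (cle n) _.
by apply: ub_le_sup; [exact: has_ubound_sdrop | exists n => /=].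
Qed.

End limn_sup_bounded.

(** Let [j n] be the largest k <= n with [m k <= n]: once n reaches both [J] and [m J], [J] is a
    candidate. *)
Lemma diagonal_index (m : nat -> nat) : exists j : nat -> nat,
  forall J, \forall n \near \oo, (J <= j n)%N /\ (m (j n) <= n)%N.
Proof.
have jP n : exists k, forall J, (J <= n)%N -> (m J <= n)%N ->
    (J <= k)%N /\ (m k <= n)%N.
  have [[i0 mi0]|no] := pselect (exists i : 'I_n.+1, m i <= n)%N; last first.
    (* Without any candidate the requirement is vacuous, so 0 is a dummy value. *)
    exists 0%N => J Jn mJ; exfalso; apply: no.
    by exists (Ordinal (Jn : (J < n.+1)%N)).
  case: (@arg_maxnP _ i0 (fun i : 'I_n.+1 => m i <= n)%N val mi0) => k mk kmax.
  by exists k => J Jn mJ; split=> //; exact: (kmax (Ordinal (Jn : J < n.+1)%N)).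
have [j jE] := choice jP.
exists j => J; exists (maxn J (m J)) => // n /=.
by rewrite geq_max => /andP[Jn mJ]; exact: jE.
Qed.

Lemma limn_sup_diagonal_cvg (R : realType) (D : nat -> nat -> nat -> R) (M : R) :
  (forall i j n, 0 <= D i j n <= M) ->
  (forall e : R, 0 < e -> exists N : nat, forall i j : nat,
     (N <= i)%N -> (N <= j)%N -> limn_sup (D i j) < e) ->
  exists j : nat -> nat,
    limn_sup (fun n => D i (j n) n) @[i --> \oo] --> (0 : R).
Proof.
move=> D0M cauchyD.
(* General index functions cover both [D i j] and the diagonal [D i (j n) n]. *)
have Dub (f g h : nat -> nat) : has_ubound (range (fun n => D (f n) (g n) (h n))).
  by exists M => _ [n _ <-]; have /andP[] := D0M (f n) (g n) (h n).
have Dlb (f g h : nat -> nat) : has_lbound (range (fun n => D (f n) (g n) (h n))).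
  by exists 0 => _ [n _ <-]; have /andP[] := D0M (f n) (g n) (h n).
have mP j : exists N, forall n i, (N <= n)%N -> (i <= j)%N ->
    D i j n < limn_sup (D i j) + j.+1%:R^-1.
  have [N _ hN] : \forall n \near \oo, forall i : 'I_j.+1,
      D i j n < limn_sup (D i j) + j.+1%:R^-1.
    (* Only finitely many i <= j occur, so one rank serves them all. *)
    apply: filter_forall => i; apply: limn_sup_lt_near.
    - exact: (Dub (fun=> i : nat) (fun=> j) id).
    - exact: (Dlb (fun=> i : nat) (fun=> j) id).
    - by rewrite ltrDl invr_gt0.
  by exists N => n i Nn ij; have := hN n Nn (Ordinal (ij : (i < j.+1)%N)).
have [m mE] := choice mP.
have [j jE] := diagonal_index m.
exists j; apply/cvgrPdist_le => e e0.
have e20 : 0 < e / 2 by rewrite divr_gt0.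
have [N cN] := cauchyD _ e20.
have [K _ hK] := near_infty_natSinv_lt (PosNum e20).
exists N => // i /= Ni.
rewrite sub0r normrN ger0_norm; last first.
  apply: limn_sup_ge => [||n]; [exact: (Dub (fun=> i))|exact: (Dlb (fun=> i))|].
  by have /andP[] := D0M i (j n) n.
apply: limn_sup_le_near; [exact: (Dub (fun=> i))|exact: (Dlb (fun=> i))|].
(* [j n >= i] permits the use of [mE] and, as i >= N, bounds the limit superior by e/2; [j n >= K]
   bounds the inverse by e/2. *)
apply: filterS (jE (maxn i K)) => n [].
rewrite geq_max => /andP[ij Kj] mj; apply: ltW.
rewrite (lt_le_trans (mE _ _ _ mj ij))// [leRHS]splitr lerD// ltW//.
  by apply: cN => //; exact: leq_trans Ni ij.
exact: hK.
Qed.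

Lemma sigma_ge0 (R : realType) (n : nat) (A : 'M[R[i]]_n) (i : nat) :
  0 <= sigma A i.
Proof.
rewrite /sigma; have [lti|gei] := ltnP i.-1 (size (singular_values A)).
  have := mem_nth 0 lti; rewrite mem_sort => /mapP[k _ ->].
  exact: sqrtr_ge0.
by rewrite nth_default.
Qed.

Lemma acs_p_ge0 (R : realType) (n : nat) (A : 'M[R[i]]_n) : 0 <= acs_p A.
Proof.
have t0 k : 0 <= acs_term A k by rewrite addr_ge0 ?sigma_ge0 ?divr_ge0.
by apply: (big_ind (fun x => 0 <= x)) => // x y x0 y0; rewrite le_min x0.
Qed.

Lemma acs_p_le1 (R : realType) (n : nat) (A : 'M[R[i]]_n.+1) : acs_p A <= 1.
Proof.
(* The last term is (n+1)/(n+1) plus a singular value read past the end of the list, hence 0. *)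
rewrite /acs_p (bigD1 ord_max)//= ge_min; apply/orP; left.
rewrite /acs_term /sigma /= divff ?pnatr_eq0// nth_default ?addr0//.
by rewrite size_sort size_map size_enum_ord.
Qed.

Theorem theorem2p1 (R : realType) (X : nat -> matseq R) :
  (forall e : R, 0 < e ->
     exists N : nat, forall j k : nat, (N <= j)%N -> (N <= k)%N ->
       d_acs (X j) (X k) < e) ->
  exists Y : matseq R, d_acs (X k) Y @[k --> \oo] --> (0 : R).
Proof.
move=> cauchyX.
(* [cauchyX] fits as it stands, since [d_acs] unfolds to [limn_sup] of this family. *)
have [i j n|j jX] := @limn_sup_diagonal_cvg R
  (fun i j n => acs_p (X i n - X j n)) 1 _ cauchyX.
  by rewrite acs_p_ge0 acs_p_le1.
by exists (fun n => X (j n) n).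
Qed.
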